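(* If $S=S(\lambda_1,\ldots,\lambda_d)$ is a spider with $d\ge 6$ legs, then there is an integer partition $\mu$ of the number of vertices of $S$ such that $S$ has no connected partition of type $\mu$; in particular, $S$ is not $e$-positive.
   Context: A spider $S(\lambda_1,\ldots,\lambda_d)$, for positive integers $\lambda_1\ge\cdots\ge\lambda_d$, is the tree consisting of a vertex $v$ (the center) together with $d$ vertex-disjoint paths (legs) having $\lambda_1,\ldots,\lambda_d$ vertices respectively, where $v$ is joined by an edge to one endpoint of each leg. A connected partition of a graph $G=(V,E)$ is a partition of $V$ into blocks each inducing a connected subgraph; its type is the integer partition of $|V|$ formed by the block sizes. The chromatic symmetric function of $G$ is $X_G=\sum_\kappa \prod_{v} x_{\kappa(v)}$ over proper colorings $\kappa$; $G$ is $e$-positive if $X_G$ is a nonnegative linear combination of elementary symmetric functions $e_\lambda$. *)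

(* Defs.v *)
From HB Require Import structures.
From mathcomp Require Import all_boot all_order all_algebra.
From mathcomp Require Import mpoly.
Set Implicit Arguments. Unset Strict Implicit. Unset Printing Implicit Defensive.
Import Order.TTheory GRing.Theory Num.Theory.

Definition induces_connected (T : finType) (e : rel T) (B : {set T}) : bool :=
  [forall x in B, forall y in B,
     connect [rel u v | [&& e u v, u \in B & v \in B]] x y].

Definition connected_partition (T : finType) (e : rel T) (P : {set {set T}}) : bool :=
  partition P [set: T] && [forall B in P, induces_connected e B].

Definition int_partition (n : nat) (mu : seq nat) : bool :=
  [&& sorted geq mu, all (fun k => 0 < k) mu & sumn mu == n].

Definition has_type (T : finType) (P : {set {set T}}) (mu : seq nat) : bool :=
  perm_eq [seq #|B| | B : {set T} <- enum P] mu.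

(* We work with n = |V| variables x_0, ..., x_{n-1} (over Q).  The map from
   homogeneous degree-n symmetric functions to symmetric polynomials in n
   variables is injective, so this loses nothing. *)

Definition proper_coloring (T : finType) (e : rel T) (k : {ffun T -> 'I_#|T|}) : bool :=
  [forall x, forall y, e x y ==> (k x != k y)].

Definition chromatic_sym (T : finType) (e : rel T) : {mpoly rat[#|T|]} :=
  \sum_(k : {ffun T -> 'I_#|T|} | proper_coloring e k) \prod_(v : T) 'X_(k v).

Definition elem_sym (n : nat) (la : seq nat) : {mpoly rat[n]} :=
  \prod_(i <- la) mesym n rat i.

Definition e_positive (T : finType) (e : rel T) : Prop :=
  exists s : seq (seq nat * rat),
    all (fun p => int_partition #|T| p.1 && (0 <= p.2)%R) s /\
    chromatic_sym e = (\sum_(p <- s) p.2 *: elem_sym #|T| p.1)%R.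

(* Legs indexed by i : 'I_(size lam); leg i has vertices j : 'I_(nth 0 lam i),
   j = 0 being the endpoint joined to the center (None). *)
Definition spider_vertex (lam : seq nat) : finType :=
  option {i : 'I_(size lam) & 'I_(nth 0 lam i)}.

Definition spider_adj (lam : seq nat) : rel (spider_vertex lam) :=
  fun x y =>
    match x, y with
    | None, None => false
    | None, Some v => val (tagged v) == 0
    | Some u, None => val (tagged u) == 0
    | Some u, Some v =>
        (tag u == tag v) &&
        (((val (tagged u)).+1 == val (tagged v)) || ((val (tagged v)).+1 == val (tagged u)))
    end.

(* Main.v *)
Require Import Defs.
From mathcomp Require Import all_boot all_order all_algebra all_field.
From mathcomp Require Import mpoly.
From mathcomp Require Import ring zify.
Set Implicit Arguments. Unset Strict Implicit. Unset Printing Implicit Defensive.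
Import Order.TTheory GRing.Theory Num.Theory.

(* In the spider, the center block of a connected partition contains every leg that
   is shorter than all blocks.  With D the length of a suitable leg (the second or
   the fourth) and s the total length of the shorter ones, all block sizes can be
   confined to a window [a, b] with D < Q a and Q b <= D + s; then that leg holds
   fewer than Q further blocks, so the center block would have to exceed b.  As
   n = |V| is a sum of integers of the window, this yields mu.

   For e-positivity, the chromatic function of a rooted tree is a signed sum, over
   sets F of edges, of the products of power sums p_|C| over the components C of F.
   Evaluate it at complex points with prescribed power sums.  If only p_n is
   nonzero, one sees that e_n occurs with a positive coefficient.  If p_k vanishes
   exactly for k outside the window, with signs making all e_k nonnegative and
   e_n > 0, an e-positive function takes a positive value, so some F has all its
   components of sizes in the window, which is impossible. *)

(** * Newton's identities and nonnegative elementary symmetric functions *)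

Section ElementaryAndPowerSums.
Local Open Scope ring_scope.

Definition prod1pX (R : comNzRingType) (r : seq R) : {poly R} :=
  \prod_(z <- r) (1 + z%:P * 'X).

Definition power_sum (R : comNzRingType) (r : seq R) (k : nat) : R :=
  \sum_(z <- r) z ^+ k.

(* Logarithmic derivative of [\prod (1 + z X)], truncated at order [N]. *)
Lemma deriv_prod1pX (R : comNzRingType) (r : seq R) (N : nat) :
  exists H : {poly R},
    (prod1pX r)^`() =
    prod1pX r * (\sum_(a < N) ((-1) ^+ a * power_sum r a.+1) *: 'X^a) + 'X^N * H.
Proof.
have geo (z : R) : exists c : {poly R},
    z%:P = (1 + z%:P * 'X) * (\sum_(a < N) ((-1) ^+ a * z ^+ a.+1) *: 'X^a)
           + 'X^N * c.
  (* Remainder of the geometric series of [z / (1 + z X)] truncated at [N]. *)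
  exists ((-1) ^+ N * z ^+ N.+1)%:P.
  elim: N => [|N IH].
    by rewrite big_ord0 mulr0 add0r !expr0 !mul1r expr1.
  have -> : (-1) ^+ N.+1 * z ^+ N.+2 = - z * ((-1) ^+ N * z ^+ N.+1).
    by rewrite !exprS; ring.
  rewrite big_ord_recr /= {1}IH -mul_polyC (polyCM (- z)) polyCN (exprS 'X N).
  by ring.
elim: r => [|z r [H IH]].
  exists 0; rewrite /prod1pX big_nil -polyC1 derivC big1 ?mulr0 ?addr0 // => a _.
  by rewrite /power_sum big_nil mulr0 scale0r.
have [c e] := geo z.
exists ((1 + z%:P * 'X) * H + prod1pX r * c).
have -> : prod1pX (z :: r) = (1 + z%:P * 'X) * prod1pX r.
  by rewrite /prod1pX big_cons.
rewrite derivM derivD -polyC1 derivC derivM derivC derivX mul0r mulr1 !add0r IH.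
have -> : \sum_(a < N) ((-1) ^+ a * power_sum (z :: r) a.+1) *: 'X^a
    = \sum_(a < N) ((-1) ^+ a * z ^+ a.+1) *: 'X^a
      + \sum_(a < N) ((-1) ^+ a * power_sum r a.+1) *: 'X^a :> {poly R}.
  rewrite -big_split /=; apply: eq_bigr => a _.
  by rewrite /power_sum big_cons mulrDr scalerDl.
rewrite {1}e polyC1.
by ring.
Qed.

(** The remainder in [deriv_prod1pX], divisible by [X^(k+1)], does not reach the coefficient of
    [X^k]. *)
Lemma newton_identity (R : comNzRingType) (r : seq R) (k : nat) :
  (prod1pX r)`_k.+1 *+ k.+1 =
  \sum_(a < k.+1) (-1) ^+ a * power_sum r a.+1 * (prod1pX r)`_(k - a).
Proof.
have [H e] := deriv_prod1pX r k.+1.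
rewrite -coef_deriv e coefD coefXnM ltnS leqnn addr0 mulrC mulr_suml coef_sum.
by apply: eq_bigr => a _; rewrite -scalerAl coefZ coefXnM ltnNge -ltnS ltn_ord.
Qed.

Lemma coef_prod1pX_mesym (R : comNzRingType) (F : nzRingType)
    (f : {rmorphism F -> R}) (n : nat) (t : n.-tuple R) (k : nat) :
  mmap f (tnth t) (mesym n F k) = (prod1pX t)`_k.
Proof.
rewrite /prod1pX big_tuple.
under eq_bigr => i _ do rewrite addrC.
rewrite bigA_distr coef_sum mesymE raddf_sum /= [LHS]big_mkcond /=.
apply: eq_bigr => h _.
have -> : \prod_i (if i \in h then (tnth t i)%:P * 'X else 1) =
          (\prod_(i in h) tnth t i)%:P * 'X^#|h|.
  by rewrite -big_mkcond /= big_split /= prodr_const rmorph_prod.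
rewrite coefCM coefXn eq_sym; case: eqP => _; rewrite ?mulr0 // mulr1.
rewrite mmapX /mmap1 [RHS]big_mkcond /=.
by apply: eq_bigr => i _; rewrite mnmE; case: (i \in h).
Qed.

(** The entries of [t] are [-1/z] for the roots [z] of [p], nonzero since [p(0) = 1], padded with
    zeros up to length [n]. *)
Lemma prod1pX_surj (F : closedFieldType) (n : nat) (p : {poly F}) :
  (size p <= n.+1)%N -> p`_0 = 1 -> exists t : n.-tuple F, prod1pX t = p.
Proof.
move=> sp p0.
have [r e] := closed_field_poly_normal p.
have pn0 : p != 0 by apply/eqP => z; move: p0; rewrite z coef0 => /eqP; rewrite eq_sym oner_eq0.
have sr : (size r <= n)%N.
  by move: sp; rewrite e size_scale ?lead_coef_eq0 // size_prod_XsubC ltnS.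
have c0 : lead_coef p * \prod_(z <- r) (- z) = 1.
  rewrite -{2}p0 {2}e coefZ -horner_coef0 horner_prod; congr (_ * _).
  by apply: eq_bigr => z _; rewrite hornerXsubC sub0r.
have rn0 z : z \in r -> z != 0.
  move=> zr; apply/eqP => z0; move: c0.
  by rewrite (big_rem z) //= z0 oppr0 mul0r mulr0 => /eqP; rewrite eq_sym oner_eq0.
have st : size ([seq - z^-1 | z <- r] ++ nseq (n - size r) 0) == n.
  by rewrite size_cat size_map size_nseq subnKC.
exists (Tuple st); rewrite /prod1pX /= big_cat /= big_map.
rewrite [X in _ * X]big1_seq ?mulr1; last first.
  by move=> z /andP[_ /nseqP[-> _]]; rewrite mul0r addr0.
rewrite [RHS]e -[LHS]scale1r -c0 -scalerA; congr (_ *: _).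
rewrite -mul_polyC rmorph_prod -big_split /=.
apply: eq_big_seq => z zr.
rewrite mulrDr mulr1 mulrA -polyCM mulrNN mulfV ?rn0 // mul1r polyCN addrC //.
Qed.

(* The elementary symmetric functions whose power sums are [(-1)^(k-1) q k],
   as dictated by Newton's identities. *)
Fixpoint elem_of_powers (R : numFieldType) (q : nat -> R) (n : nat) : seq R :=
  if n is m.+1 then
    let s := elem_of_powers q m in
    rcons s ((\sum_(i < m.+1) q i.+1 * s`_(m - i)) / m.+1%:R)
  else [:: 1].

Variables (R : numFieldType) (q : nat -> R).
Notation E k := ((elem_of_powers q k)`_k).

Lemma size_elem_of_powers n : size (elem_of_powers q n) = n.+1.
Proof. by elim: n => //= n IH; rewrite size_rcons IH. Qed.

Lemma nth_elem_of_powers n k : (k <= n)%N -> (elem_of_powers q n)`_k = E k.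
Proof.
elim: n => [|n IH]; first by rewrite leqn0 => /eqP ->.
rewrite leq_eqVlt => /predU1P[-> //|kn] /=.
by rewrite nth_rcons size_elem_of_powers kn IH.
Qed.

Lemma elem_of_powersS n :
  E n.+1 *+ n.+1 = \sum_(i < n.+1) q i.+1 * E (n - i).
Proof.
rewrite /= nth_rcons size_elem_of_powers ltnn eqxx -[LHS]mulr_natr divfK ?pnatr_eq0 //.
by apply: eq_bigr => i _; rewrite nth_elem_of_powers ?leq_subr.
Qed.

Hypothesis q0 : forall k, 0 <= q k.

Lemma elem_of_powers_ge0 n : 0 <= E n.
Proof.
elim/ltn_ind: n => -[|n] IH; first exact: ler01.
rewrite -(pmulrn_lge0 _ (ltn0Sn n)) elem_of_powersS sumr_ge0 // => i _.
by rewrite mulr_ge0 // IH // ltnS leq_subr.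
Qed.

(** The recurrence contains [q k] times the value at the sum of the remaining parts, positive by
    induction; its other terms are nonnegative. *)
Lemma elem_of_powers_gt0 (mu : seq nat) :
  all (fun k => (0 < k)%N && (0 < q k)) mu -> 0 < E (sumn mu).
Proof.
elim: mu => [_|k mu IH /= /andP[/andP[k0 qk] /IH Emu]]; first exact: ltr01.
case: k k0 qk => // k _ qk; rewrite addSn.
rewrite -(pmulrn_lgt0 _ (ltn0Sn (k + sumn mu))) elem_of_powersS.
have kS : (k < (k + sumn mu).+1)%N by rewrite ltnS leq_addr.
rewrite (bigD1 (Ordinal kS)) //= addKn ltr_wpDr ?mulr_gt0 //.
by rewrite sumr_ge0 // => i _; rewrite mulr_ge0 // elem_of_powers_ge0.
Qed.

End ElementaryAndPowerSums.

(** * Points with prescribed power sums *)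

Section PrescribedPowerSums.
Local Open Scope ring_scope.

(** Choose [t] with the prescribed elementary symmetric functions. By induction Newton's identity
    and the recurrence agree term by term up to the last one, which gives the next power sum. *)
Lemma realize_power_sums (C : numClosedFieldType) (q : nat -> C) (n : nat) :
  exists t : n.-tuple C,
    (forall k, (k <= n)%N -> (prod1pX t)`_k = (elem_of_powers q k)`_k) /\
    (forall k, (0 < k <= n)%N -> power_sum t k = (-1) ^+ k.-1 * q k).
Proof.
have [||t et] := @prod1pX_surj C n (Poly (elem_of_powers q n)).
- by rewrite (leq_trans (size_Poly _)) // size_elem_of_powers.
- by rewrite coef_Poly nth_elem_of_powers.
have Et k : (k <= n)%N -> (prod1pX t)`_k = (elem_of_powers q k)`_k.
  by move=> kn; rewrite et coef_Poly nth_elem_of_powers.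
exists t; split=> // -[//|k] /=; elim/ltn_ind: k => k IH kn.
have := newton_identity t k.
rewrite Et // elem_of_powersS !big_ord_recr /= subnn (Et 0%N) //= !mulr1.
have -> : \sum_(i < k) (-1) ^+ i * power_sum t i.+1 * (prod1pX t)`_(k - i) =
          \sum_(i < k) q i.+1 * (elem_of_powers q (k - i))`_(k - i).
  apply: eq_bigr => i _.
  rewrite IH ?(ltn_trans _ kn) // Et ?(leq_trans (leq_subr _ _)) 1?ltnW //.
  by rewrite mulrA -expr2 sqrr_sign mul1r.
by move=> /addrI ->; rewrite mulrA -expr2 sqrr_sign mul1r.
Qed.

End PrescribedPowerSums.

(** * Chromatic symmetric functions of rooted trees *)

Section RootedTree.
Variables (T : finType) (e : rel T) (root : T) (par : T -> T) (depth : T -> nat).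
Hypothesis depth_par : forall v, v != root -> depth (par v) < depth v.
Hypothesis adj_par : forall x y,
  e x y = ((x != root) && (par x == y)) || ((y != root) && (par y == x)).

(* [F] is a set of non-root vertices; each [v] in [F] stands for the edge from
   [v] to its parent, and [rep F v] is the top vertex of the component of [v]
   in the forest formed by these edges. *)
Definition climb (F : {set T}) (v : T) := if v \in F then par v else v.
Definition rep (F : {set T}) (v : T) := iter (\max_u depth u) (climb F) v.

Section Components.
Variable F : {set T}.
Hypothesis rootF : root \notin F.

(** Each step inside [F] lowers the depth, so the maximal depth is enough iterations to leave
    [F]. *)
Lemma rep_notin v : rep F v \notin F.
Proof.
rewrite /rep; have : depth v <= \max_u depth u by exact: leq_bigmax.
elim: (\max_u _) v => [|m IH] v /= dv.
  apply/negP => vF; have vr : v != root by apply: contraNneq rootF => <-.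
  by have := depth_par vr; move: dv; rewrite leqn0 => /eqP ->.
rewrite -iterS iterSr; case vF: (v \in F).
  rewrite /climb vF; apply: IH; rewrite -ltnS (leq_trans _ dv) // depth_par //.
  by apply: contraNneq rootF => <-.
have fx : climb F v = v by rewrite /climb vF.
rewrite fx; have -> : iter m (climb F) v = v by elim: m {IH dv} => //= m ->.
by rewrite vF.
Qed.

Lemma rep_id v : v \notin F -> rep F v = v.
Proof.
by move=> vF; rewrite /rep; elim: (\max_u _) => //= m ->; rewrite /climb (negbTE vF).
Qed.

Lemma rep_climb v : rep F (climb F v) = rep F v.
Proof.
rewrite /rep -iterSr iterS -/(rep F v).
by rewrite /climb (negbTE (rep_notin v)).
Qed.

(** Such a coloring is a free choice of color at the top of each component, so the sum factors over
    components. *)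
Lemma sum_monochromatic (R : comNzRingType) (J : finType) (j0 : J) (x : J -> R) :
  (\sum_(k : {ffun T -> J} | [forall v in F, k v == k (par v)]) \prod_v x (k v) =
   \prod_(r in ~: F) \sum_j x j ^+ #|[set v | rep F v == r]|)%R.
Proof.
rewrite (big_distr_big j0).
(* [h] spreads the colors of the tops over their components; [g] keeps only those colors, with the
   default [j0] on [F]. *)
pose h (f : {ffun T -> J}) := [ffun v => f (rep F v)].
pose g (f : {ffun T -> J}) := [ffun v => if v \in F then j0 else f v].
rewrite (reindex_onto h g) /=; last first.
  move=> k /forall_inP kF; apply/ffunP => v.
  rewrite !ffunE (negbTE (rep_notin v)) /rep.
  elim: (\max_u _) => //= m IH; rewrite {1}/climb; case: ifP => // /kF /eqP <- //.
apply: eq_big => [f|f _].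
  apply/andP/pffun_onP => [[_ /eqP <-]|[sf _]].
    split=> [|y]; last by [].
    by apply/supportP => v; rewrite in_setC negbK => vF; rewrite !ffunE vF.
  split.
    apply/forall_inP => v vF; rewrite !ffunE -(rep_climb v) /climb vF //.
  apply/eqP/ffunP => v; rewrite !ffunE; case: ifP => [vF|/negbT vF].
    by move/supportP: sf => /(_ v) ->; rewrite // in_setC vF.
  by rewrite rep_id.
rewrite (partition_big (rep F) (mem (~: F))) /=; last first.
  by move=> v _; rewrite in_setC rep_notin.
apply: eq_bigr => r _; rewrite -prodr_const.
by apply: eq_big => [v|v /eqP vr]; rewrite ?inE // ffunE vr.
Qed.

(** Vertices of a block climb to their common top without leaving the block. *)
Lemma components_connected : connected_partition e (preim_partition (rep F) [set: T]).
Proof.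
rewrite /connected_partition preim_partitionP /=.
apply/forall_inP => B /imsetP[b _ eB].
have inB v : (v \in B) = (rep F b == rep F v) by rewrite eB inE in_setT.
have esym : ssrbool.symmetric e by move=> x y; rewrite !adj_par orbC.
set eB' := [rel u v | [&& e u v, u \in B & v \in B]].
have csym : connect_sym eB'.
  by apply: sym_connect_sym => x y /=; rewrite esym [X in _ && X]andbC.
have up x : x \in B -> connect eB' x (rep F x).
  move=> xB; rewrite /rep.
  suff H m : (iter m (climb F) x \in B) && connect eB' x (iter m (climb F) x).
    by case/andP: (H (\max_u depth u)).
  elim: m => [|m /andP[mB cm]] /=; first by rewrite xB connect0.
  have SB : climb F (iter m (climb F) x) \in B by rewrite inB rep_climb -inB.
  rewrite SB /=; apply: (connect_trans cm).
  move: SB mB; set y := iter m _ x; rewrite /climb; case: ifP => // yF pB yB.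
  apply: connect1; rewrite /= pB yB adj_par eqxx andbT.
  by have -> : y != root by apply: contraNneq rootF => <-.
apply/forall_inP => x xB; apply/forall_inP => y yB.
apply: (connect_trans (up x xB)); rewrite csym.
by have := up y yB; move: xB yB; rewrite !inB => /eqP <- /eqP <-.
Qed.

End Components.

Section Evaluation.
Local Open Scope ring_scope.
Variables (R : fieldType) (f : {rmorphism rat -> R}) (t : #|T|.-tuple R).
Notation ev := (mmap f (tnth t)).

(** Inclusion-exclusion: properness is the product over [v != root] of [1 - [k v = k (par v)]], and
    [F] records where the second term is taken. *)
Lemma ev_chromatic :
  ev (chromatic_sym e) =
  \sum_(F : {set T} | root \notin F) (-1) ^+ #|F| *
     \prod_(r in ~: F) power_sum t #|[set v | rep F v == r]|.
Proof.
rewrite /chromatic_sym raddf_sum /=.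
pose bad (k : {ffun T -> 'I_#|T|}) v := (v != root) && (k v == k (par v)).
transitivity (\sum_(k : {ffun T -> 'I_#|T|}) \sum_(F : {set T} | root \notin F)
   (-1) ^+ #|F| * (if [forall v in F, k v == k (par v)] then \prod_v tnth t (k v) else 0)).
  rewrite big_mkcond; apply: eq_bigr => k _.
  transitivity ((\prod_v (- (bad k v)%:R + 1)) * \prod_v tnth t (k v)).
    have [pk|npk] := boolP (proper_coloring e k).
      rewrite [X in _ = X * _]big1 => [|v _].
        rewrite mul1r rmorph_prod; apply: eq_bigr => v _ /=.
        by rewrite mmapX mmap1U.
      rewrite /bad; case: (boolP (v == root)) => [_|vr] /=; first by rewrite oppr0 add0r.
      move/forallP/(_ v)/forallP/(_ (par v))/implyP: pk.
      by rewrite adj_par vr eqxx => /(_ isT) /negbTE ->; rewrite oppr0 add0r.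
    move: npk; rewrite negb_forall => /existsP[x]; rewrite negb_forall => /existsP[y].
    rewrite negb_imply negbK adj_par => /andP[exy kxy].
    have [v bv] : exists v, bad k v.
      case/orP: exy => /andP[xr /eqP xy]; [exists x | exists y]; rewrite /bad xr xy //=.
      by rewrite eq_sym.
    by rewrite (bigD1 v) //= bv addNr !mul0r.
  rewrite bigA_distr mulr_suml [RHS]big_mkcond; apply: eq_bigr => F _.
  case: (boolP (root \in F)) => [rF|rF] /=.
    by rewrite (bigD1 root) //= rF /bad eqxx /= oppr0 !mul0r.
  rewrite -big_mkcond /= prodrN -mulrA; congr (_ * _).
  case: (boolP [forall v in F, _]) => [/forall_inP H|].
    rewrite big1 ?mul1r // => v vF; rewrite /bad H // andbT.
    by have -> : v != root by apply: contraNneq rF => <-.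
  rewrite negb_forall_in => /exists_inP[v vF /negbTE kv].
  by rewrite (bigD1 v) //= /bad kv andbF !mul0r.
rewrite exchange_big /=; apply: eq_bigr => F rF.
rewrite -mulr_sumr -big_mkcond /= (sum_monochromatic rF (enum_rank root)).
congr (_ * _); apply: eq_bigr => r _.
by rewrite /power_sum big_tuple.
Qed.

Lemma ev_chromatic_neq0 : ev (chromatic_sym e) != 0 ->
  exists P : {set {set T}}, connected_partition e P /\
    forall B, B \in P -> power_sum t #|B| != 0.
Proof.
rewrite ev_chromatic => X0.
have [F rF tF] : exists2 F : {set T}, root \notin F &
    \prod_(r in ~: F) power_sum t #|[set v | rep F v == r]| != 0.
  apply/exists_inP; apply: contraNT X0; rewrite negb_exists_in => /forall_inP H.
  by rewrite big1 // => F /H; rewrite negbK => /eqP ->; rewrite mulr0.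
exists (preim_partition (rep F) [set: T]); split; first exact: components_connected.
move=> B /imsetP[b _ ->]; move/prodf_neq0: tF => /(_ (rep F b)).
rewrite in_setC rep_notin // => /(_ isT).
suff -> : [set v | rep F v == rep F b] = [set y in [set: T] | rep F b == rep F y] by [].
by apply/setP => v; rewrite !inE eq_sym.
Qed.

(** For [[set~ root]] the whole tree is one component. Any other [F] misses some [r != root], whose
    component omits the root, so its power sum vanishes. *)
Lemma ev_chromatic_top :
  (forall k, (0 < k < #|T|)%N -> power_sum t k = 0) ->
  ev (chromatic_sym e) = (-1) ^+ #|T|.-1 * power_sum t #|T|.
Proof.
move=> p0; rewrite ev_chromatic (bigD1 [set~ root]) ?inE ?eqxx //=.
rewrite [X in _ + X]big1 ?addr0 => [|F /andP[rF FE]]; last first.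
  have [r rr rF'] : exists2 r, r != root & r \notin F.
    apply/exists_inP; apply: contraNT FE; rewrite negb_exists_in => /forall_inP H.
    apply/eqP/setP => v; rewrite !inE; case: (altP (v =P root)) => [->|/H].
      exact: negbTE.
    by rewrite negbK.
  rewrite (bigD1 r) ?in_setC //=.
  suff blk : (0 < #|[set v | rep F v == r]| < #|T|)%N by rewrite p0 // mul0r mulr0.
  apply/andP; split.
    by apply/card_gt0P; exists r; rewrite inE rep_id.
  rewrite ltn_neqAle max_card andbT -cardsT; apply: contra_neq rr => cB.
  have /eqP/setP/(_ root) : [set v | rep F v == r] == [set: T].
    by rewrite eqEcard subsetT cB /=.
  by rewrite !inE rep_id // => /eqP.
have rF : root \notin [set~ root] by rewrite !inE eqxx.
rewrite setCK big_set1 cardsC1; congr (_ * power_sum _ _).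
rewrite -cardsT; congr #|pred_of_set _|; apply/setP => v.
by have := rep_notin rF v; rewrite !inE negbK.
Qed.

End Evaluation.

Section EPositivity.
Local Open Scope ring_scope.

Lemma ev_e_expansion (s : seq (seq nat * rat)) (q : nat -> algC) (t : #|T|.-tuple algC) :
  all (fun p => int_partition #|T| p.1 && (0 <= p.2)) s ->
  (forall k, (k <= #|T|)%N -> (prod1pX t)`_k = (elem_of_powers q k)`_k) ->
  mmap ratr (tnth t) (\sum_(p <- s) p.2 *: elem_sym #|T| p.1) =
  \sum_(p <- s) ratr p.2 * \prod_(i <- p.1) (elem_of_powers q i)`_i.
Proof.
move=> /allP sP Et; rewrite raddf_sum; apply: eq_big_seq => p /sP.
case/andP=> /and3P[_ _ /eqP sp] _.
rewrite /= mmapZ /elem_sym rmorph_prod /=; congr (_ * _).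
apply: eq_big_seq => i ip; rewrite coef_prod1pX_mesym Et // -sp.
by rewrite sumnE (big_rem i) //= leq_addr.
Qed.

(** For [q] the indicator of [n = #|T|], all [e_k] with [0 < k < n] vanish, so only [e_n] can
    contribute to the value 1 of the chromatic function. *)
Lemma e_positive_top_coef (s : seq (seq nat * rat)) :
  all (fun p => int_partition #|T| p.1 && (0 <= p.2)) s ->
  chromatic_sym e = \sum_(p <- s) p.2 *: elem_sym #|T| p.1 ->
  exists2 c, 0 < c & ([:: #|T|], c) \in s.
Proof.
move=> sP eX; have n0 : (0 < #|T|)%N by apply/card_gt0P; exists root.
pose q k : algC := (k == #|T|)%:R.
have [t [Et pt]] := realize_power_sums q #|T|.
have pk k : (0 < k < #|T|)%N -> power_sum t k = 0.
  by case/andP=> k0 kn; rewrite pt ?k0 1?ltnW // /q ltn_eqF // mulr0.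
have X1 : mmap ratr (tnth t) (chromatic_sym e) = 1.
  rewrite ev_chromatic_top // pt ?n0 //= /q eqxx mulr1.
  by rewrite -expr2 sqrr_sign.
have Ek k : (0 < k < #|T|)%N -> (elem_of_powers q k)`_k = 0.
  case: k => // k /= kn; apply/eqP; rewrite -[_ == 0](mulrn_eq0 _ k.+1) /=.
  rewrite elem_of_powersS big1 // => i _.
  by rewrite /q ltn_eqF ?mul0r // (leq_ltn_trans _ kn).
have := X1; rewrite eX (ev_e_expansion sP Et) => X1'.
have [/hasP[[la c] ls /= /andP[/eqP el c0]]|/hasPn H] :=
  boolP (has (fun p => (p.1 == [:: #|T|]) && (p.2 != 0)) s).
  exists c; last by rewrite -el.
  by rewrite lt_neqAle eq_sym c0; have /andP[_ ] := allP sP _ ls.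
move: X1'; rewrite big1_seq => [/eqP|p /andP[_ ps]]; first by rewrite eq_sym oner_eq0.
have /andP[/and3P[_ /allP pos /eqP sm] _] := allP sP _ ps.
have := H _ ps; rewrite negb_and negbK => /orP[ne|/eqP ->]; last by rewrite rmorph0 mul0r.
suff [i ip ki] : exists2 i, i \in p.1 & (0 < i < #|T|)%N.
  by rewrite (big_rem i) //= Ek // mul0r mulr0.
case: p.1 pos sm ne => [|i [|j l]] pos sm ne.
- by move: n0; rewrite -sm.
- by move: ne; rewrite -sm /= addn0 eqxx.
- exists i; rewrite ?mem_head // pos ?mem_head //= -sm /= -addn1 leq_add2l.
  by rewrite (leq_trans (pos j _)) ?leq_addr // !inE eqxx orbT.
Qed.

(* Evaluate at variables whose power sums [p_k] vanish for [k] outside [S] while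
   the elementary symmetric functions are nonnegative, with [e_n > 0]. *)
Lemma e_positive_connected_partition (S : pred nat) (mu : seq nat) :
  e_positive e -> int_partition #|T| mu -> all S mu ->
  exists P : {set {set T}}, connected_partition e P /\ forall B, B \in P -> S #|B|.
Proof.
case=> s [sP eX] /and3P[_ mu0 /eqP smu] Smu.
have [c c0 cs] := e_positive_top_coef sP eX.
pose q k : algC := (S k)%:R.
have q0 k : 0 <= q k by rewrite ler0n.
have [t [Et pt]] := realize_power_sums q #|T|.
have Xgt0 : 0 < mmap ratr (tnth t) (chromatic_sym e).
  rewrite eX (ev_e_expansion sP Et) (big_rem _ cs) /= ltr_wpDr //.
    rewrite big_seq sumr_ge0 // => p /mem_rem ps.
    have /andP[_ p0] := allP sP _ ps.
    by rewrite mulr_ge0 ?ler0q // prodr_ge0 // => i _; apply: elem_of_powers_ge0.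
  (* The [e_n] term is strictly positive because [mu] writes [n] with parts in [S]. *)
  rewrite mulr_gt0 ?ltr0q // big_seq1 -smu elem_of_powers_gt0 //.
  by rewrite all_predI mu0 (eq_all (a2 := S)) // => k; rewrite ltr0n lt0b.
have [P [cP PS]] := ev_chromatic_neq0 (lt0r_neq0 Xgt0).
exists P; split=> // B BP; have := PS B BP.
have B0 : (0 < #|B|)%N.
  case/andP: cP => /and3P[_ _ P0] _; rewrite card_gt0.
  by apply: contraNneq P0 => <-.
rewrite pt ?B0 ?max_card // /q.
by case: (S _); rewrite // mulr0 eqxx.
Qed.

End EPositivity.

End RootedTree.

(** * Integer partitions with parts in a window *)

Lemma balanced_parts (n m a b : nat) : 0 < m -> 0 < a -> m * a <= n <= m * b ->
  exists mu, int_partition n mu /\ all (fun k => a <= k <= b) mu.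
Proof.
move=> m0 a0 /andP[man nmb]; have en := divn_eq n m; have rm := ltn_pmod n m0.
set q := n %/ m in en; set r := n %% m in en rm.
have aq : a <= q by rewrite leq_divRL // mulnC.
exists (nseq r q.+1 ++ nseq (m - r) q); split.
  apply/and3P; split.
  - apply: (@path_sorted _ _ q.+1).
    elim: r (m - r) {en rm} => [|r IH] c /=; last by rewrite leqnn IH.
    case: c => //= c; rewrite leqnSn /=.
    by elim: c => //= c IH; rewrite leqnn.
  - by rewrite all_cat !all_nseq /= orbT (leq_trans a0 aq) orbT.
  - by rewrite sumn_cat !sumn_nseq; apply/eqP; nia.
have qb : q <= b by nia.
rewrite all_cat !all_nseq aq qb orbT andbT (leqW aq) /=.
(* A part [q + 1] occurs only if [r > 0], and then [m q < n <= m b]. *)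
by case: (posnP r) => //= r0; nia.
Qed.

(** * Connected partitions of spiders *)

Section SpiderPartitions.
Variable lam : seq nat.
Notation V := (spider_vertex lam).

Lemma card_spider_legs (p : pred 'I_(size lam)) (b : bool) :
  #|[set x : V | if x is Some v then p (tag v) else b]| =
  b + \sum_(i | p i) nth 0 lam i.
Proof.
rewrite -sum1_card big_mkcond /=.
rewrite (bigD1 None) //=; congr (_ + _); first by rewrite inE; case: b.
rewrite (reindex_omap Some id) /=; last by case.
rewrite -big_mkcondr /=.
transitivity (\sum_(i | p i) \sum_(j < nth 0 lam i) 1).
  rewrite sig_big_dep /=; apply: eq_bigl => -[i j] /=.
  by rewrite inE eqxx /= andbT.
by apply: eq_bigr => i _; rewrite sum1_card card_ord.
Qed.

Lemma card_spider : #|V| = (sumn lam).+1.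
Proof.
rewrite -cardsT sumnE (big_nth 0) big_mkord -add1n -(card_spider_legs predT true).
by congr #|pred_of_set _|; apply/setP => -[v|]; rewrite !inE.
Qed.

(** A path avoiding the center never changes legs. *)
Lemma spider_connected_leg (B : {set V}) (x y : {i : 'I_(size lam) & 'I_(nth 0 lam i)}) :
  induces_connected (@spider_adj lam) B -> None \notin B ->
  Some x \in B -> Some y \in B -> tag x = tag y.
Proof.
move=> /forall_inP cB NB xB yB; have /forall_inP/(_ _ yB)/connectP[p] := cB _ xB.
elim: p x xB => [|[z|] p IH] x xB /=; first by move=> _ [->].
  by case/andP=> /and3P[/andP[/eqP exz _] _ zB] pp /(IH z zB pp) <-.
by case/andP=> /and3P[_ _ NB']; rewrite NB' in NB.
Qed.

(* The center block contains every leg after the [j]-th, these being too short to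
   hold a block, and leg [j] holds fewer than [Q] further blocks; so the blocks
   meeting the center or the legs from the [j]-th on are too small to cover them. *)
Lemma spider_no_partition (j Q a b : nat) (P : {set {set V}}) :
  j < size lam -> nth 0 lam j < Q * a -> Q * b <= sumn (drop j lam) ->
  (forall i, j < i -> nth 0 lam i < a) ->
  connected_partition (@spider_adj lam) P ->
  ~ (forall B, B \in P -> a <= #|B| <= b).
Proof.
move=> jl Da bs short /andP[partP /forall_inP conP] sz.
pose U := [set x : V | if x is Some v then j <= tag v else true].
pose L := [set x : V | if x is Some v then tag v == j :> nat else false].
have cU : #|U| = (sumn (drop j lam)).+1.
  rewrite (card_spider_legs (fun i => j <= i) true) add1n; congr _.+1.
  rewrite -(big_mkord (fun i => j <= i) (nth 0 lam)) (big_cat_nat (n := j)) ?(ltnW jl) //=.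
  rewrite big_nat_cond big1 ?add0n => [|i /andP[/andP[_ ij] ji]]; last by lia.
  rewrite big_nat_cond (eq_bigl (fun i => (j <= i < size lam))) => [|i]; last by lia.
  rewrite -big_nat sumnE [RHS](big_nth 0) size_drop -{1}[j]add0n big_addn big_nat [RHS]big_nat.
  by apply: eq_bigr => i _; rewrite nth_drop addnC.
have cL : #|L| = nth 0 lam j.
  rewrite (card_spider_legs (fun i => i == j :> nat) false) add0n.
  by rewrite (big_pred1 (Ordinal jl)) //.
have sumP (W : {set V}) : #|W| = \sum_(B in P) #|B :&: W|.
  rewrite -sum1_card big_mkcond /=.
  rewrite (eq_bigl (fun x => x \in [set: V])) => [|x]; last by rewrite in_setT.
  rewrite (set_partition_big _ partP) /=; apply: eq_bigr => B _.
  by rewrite -big_mkcondr -sum1_card; apply: eq_bigl => x; rewrite inE.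
pose K := #|[set B in P | B \subset L]|.
have KQ : K < Q.
  suff : K * a <= nth 0 lam j by nia.
  rewrite -cL sumP -sum_nat_const.
  rewrite [X in _ <= X](bigID (fun B : {set V} => B \subset L)) /= (leq_trans _ (leq_addr _ _)) //.
  rewrite (eq_bigl (fun B : {set V} => (B \in P) && (B \subset L))) => [|B]; last by rewrite inE.
  by apply: leq_sum => B /andP[/sz/andP[aB _] /setIidPl ->].
have tP : trivIset P by case/and3P: partP.
have covN : None \in cover P by rewrite (cover_partition partP) inE.
have CP : pblock P None \in P by exact: pblock_mem.
(* Only the center block and the [K < Q] blocks inside [L] meet [U], so [#|U| <= Q * b]; but the
   center makes [#|U|] exceed [sumn (drop j lam)]. *)
have := sumP U; rewrite cU (bigD1 (pblock P None)) //=.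
suff : \sum_(B in P | B != pblock P None) #|B :&: U| <= K * b.
  move=> sumK eU; have /andP[_ Cb] := sz _ CP.
  have CUb := leq_trans (subset_leq_card (subsetIl (pblock P None) U)) Cb.
  have : (sumn (drop j lam)).+1 <= b + K * b by rewrite eU leq_add.
  by have := leq_mul KQ (leqnn b); rewrite mulSn; lia.
rewrite -sum_nat_const [X in _ <= X](eq_bigl (fun B : {set V} => (B \in P) && (B \subset L))); last first.
  by move=> B; rewrite inE.
rewrite big_mkcond [X in _ <= X]big_mkcond; apply: leq_sum => B _.
case: ifP => // /andP[BP BC]; rewrite BP /=.
have NB : None \notin B.
  by apply: contra BC => NB; rewrite (def_pblock tP BP NB).
have [->|[[v|] ]] := set_0Vmem (B :&: U); first by rewrite cards0.
  rewrite !inE => /andP[vB jv].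
  have leg (w : V) : w \in B -> if w is Some u then tag u == tag v else false.
    case: w => [u uB|NB']; first by apply/eqP; apply: spider_connected_leg (conP _ BP) NB uB vB.
    by rewrite NB' in NB.
  (* [B] lies in one leg, and the legs after the [j]-th are too short to contain it. *)
  have vj : tag v = j :> nat.
    apply/eqP; rewrite eqn_leq jv andbT leqNgt; apply/negP => /short.
    rewrite ltnNge; case/negP; have /andP[aB _] := sz _ BP; apply: (leq_trans aB).
    rewrite -[X in _ <= X](big_pred1_eq addn (tag v) (fun i => nth 0 lam i)).
    rewrite -[X in _ <= X](card_spider_legs (pred1 (tag v)) false) subset_leq_card //.
    by apply/subsetP => w /leg; rewrite inE.
  have -> : B \subset L.
    by apply/subsetP => -[w|] /leg; rewrite inE // => /eqP ->; rewrite vj.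
  have /andP[_ Bb] := sz _ BP.
  by rewrite (leq_trans (subset_leq_card (subsetIl _ _))).
by rewrite !inE (negbTE NB).
Qed.

(** The spider is rooted at its center, where the value is a dummy. *)
Definition spider_parent (x : V) : V :=
  if x is Some u then
    if val (tagged u) == 0 then None
    else Some (Tagged (fun i : 'I_(size lam) => 'I_(nth 0 lam i))
                 (Ordinal (leq_ltn_trans (leq_pred (tagged u)) (ltn_ord (tagged u)))))
  else None.

Definition spider_depth (x : V) : nat :=
  if x is Some u then (val (tagged u)).+1 else 0.

Lemma spider_depth_parent (x : V) :
  x != None -> spider_depth (spider_parent x) < spider_depth x.
Proof. by case: x => [[i [[|j] lj]]|]. Qed.

Lemma spider_adj_parent (x y : V) :
  spider_adj x y =
  ((x != None) && (spider_parent x == y)) || ((y != None) && (spider_parent y == x)).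
Proof.
have parE (u v : {i : 'I_(size lam) & 'I_(nth 0 lam i)}) :
    (spider_parent (Some u) == Some v) =
    (tag u == tag v) && ((val (tagged v)).+1 == val (tagged u)).
  case: u v => [i x'] [k y'] /=; apply/eqP/andP => [|[/eqP eik]].
    case: ifP => // /negbT x0.
    move=> /(congr1 (fun w : V => if w is Some w' then (val (tag w'), val (tagged w'))
                                  else (0, 0))) /= [/val_inj eik <-].
    by split; [apply/eqP | rewrite prednK ?lt0n].
  case: _ / eik y' => y' /eqP e; case: ifP => [/eqP x0|_]; first by rewrite x0 in e.
  congr (Some (Tagged _ _)).
  by apply: val_inj; rewrite /= -e.
case: x y => [u|] [v|] //=.
- by rewrite -!/(spider_parent (Some _)) !parE [tag v == _]eq_sym -andb_orr orbC.
- by rewrite orbF; case: ifP.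
- by case: ifP.
Qed.

End SpiderPartitions.

(** * Choice of the window from the leg lengths *)

Lemma sorted_geq_nth (s : seq nat) (i k : nat) :
  sorted geq s -> i <= k -> nth 0 s k <= nth 0 s i.
Proof.
move=> ss ik; have [ks|sk] := ltnP k (size s); last by rewrite nth_default.
have gt : transitive geq by move=> y x z /= xy yz; exact: leq_trans yz xy.
by apply: (sorted_leq_nth gt leqnn 0 ss) => //; exact: leq_ltn_trans ks.
Qed.

(** [A] is least with [D < Q A] and [b] greatest with [Q b <= D + s]. For [m = n %/ A], the
    remainder is below [A], so [m (b - A) >= A] suffices; the bound [n < l (l + 1)] makes [s] large
    enough against [Q] for this. *)
Lemma wide_spider_parameters (l1 D s l : nat) (Q := D.+1 %/ s) (A := (D %/ Q).+1)
    (b := (D + s) %/ Q) (n := (l1 + (D + s)).+1) :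
  D <= l1 -> 2 * l.+1 <= s -> n < l * l.+1 -> 1 < Q ->
  [/\ D < Q * A, Q * b <= D + s, s <= A, 0 < n %/ A & n %/ A * A <= n <= n %/ A * b].
Proof.
move=> Dl1 ls nl Q2.
have s0 : 0 < s by lia.
have sQ : Q * s <= D.+1 by rewrite leq_divM.
have Qs : D.+1 < Q.+1 * s by rewrite ltn_ceil.
have Ql : 2 * (2 * Q).+1 <= l.
  rewrite -(leq_pmul2r (ltn0Sn l)).
  have h : (2 * Q).+1 * (2 * l.+1) <= (2 * Q).+1 * s by rewrite leq_mul2l ls orbT.
  have h' : (2 * Q).+1 * s <= n.+1 by rewrite mulSn -mulnA /n; lia.
  by rewrite -mulnA mulnCA; apply: leq_trans h (leq_trans h' nl).
have sQ8 : 8 * Q + 6 <= s by lia.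
have Q0 : 0 < Q by exact: ltnW.
have eD := divn_eq D Q; have rD := ltn_pmod D Q0.
have eB := divn_eq (D + s) Q; have rB := ltn_pmod (D + s) Q0.
rewrite -/b in eB.
have eA : Q * A = D %/ Q * Q + Q by rewrite /A mulnS mulnC addnC.
have DA : D < Q * A by rewrite eA; lia.
have QA : Q * A <= D + Q by rewrite eA; lia.
have m2 : 2 * Q <= n %/ A.
  by rewrite leq_divRL // -mulnA /n; lia.
have gap : A + 2 * Q * A <= 2 * Q * b.
  (* Rounding in [A] and [b] costs [Q (b - A)] at most [2 Q - 1] out of [s]. *)
  have Ab : Q * A + s + 1 <= Q * b + 2 * Q by rewrite (mulnC Q b); lia.
  suff As : A + 4 * Q <= 2 * s + 2 by rewrite -!mulnA; lia.
  rewrite -(leq_pmul2l Q0) !mulnDr.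
  have [Q' eQ] : exists k, Q = k + 2 by exists (Q - 2); lia.
  have [s' es] : exists k, s = 8 * Q + 6 + k by exists (s - (8 * Q + 6)); lia.
  suff : s + Q * (4 * Q) <= Q * s + Q + 2 by rewrite mulSn in Qs; lia.
  clearbody Q; clear -eQ es; subst s Q; nia.
split=> //.
- by rewrite mulnC leq_divM.
- have [s' es] : exists k, s = k.+1 by exists s.-1; rewrite prednK.
  rewrite {1}es ltnS leq_divRL //; move: sQ; rewrite es mulnS; lia.
- by lia.
rewrite leq_divM /=.
have en := divn_eq n A; have rn : n %% A < A by rewrite ltn_pmod.
have [c ec] : exists c, b = A + c.
  exists (b - A); rewrite subnKC // -(leq_pmul2l Q0); lia.
have cA : A <= 2 * Q * c by move: gap; rewrite ec mulnDr; lia.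
have : 2 * Q * c <= n %/ A * c by rewrite leq_mul2r m2 orbT.
by rewrite ec mulnDr; lia.
Qed.

(** If [n >= l4 (l4 + 1)], at least [l4] parts [l4 + 1] or [l4 + 2] absorb any remainder, and the
    fourth leg serves. Otherwise the second does, with [Q = 1] or [Q = l2.+1 %/ s]. The fifth and
    sixth legs give both [l4 + 2 <= l4 + l5 + l6] and [2 (l4 + 1) <= s]. *)
Lemma spider_parameters (lam : seq nat) :
  sorted geq lam -> all (fun k => 0 < k) lam -> 6 <= size lam ->
  exists j Q a b m : nat,
    [/\ j < size lam, nth 0 lam j < Q * a, Q * b <= sumn (drop j lam),
        forall i, j < i -> nth 0 lam i < a &
        [/\ 0 < a, 0 < m & m * a <= (sumn lam).+1 <= m * b]].
Proof.
move=> ss pos sz.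
have bound i k := @sorted_geq_nth lam i k ss.
case: lam sz ss pos bound => [|l1 [|l2 [|l3 [|l4 [|l5 [|l6 r]]]]]] //= _.
move=> _ /and5P[_ _ _ _ /and3P[p5 p6 _]] bound.
have l12 : l2 <= l1 := bound 0 1 isT.
have l23 : l3 <= l2 := bound 1 2 isT.
have l34 : l4 <= l3 := bound 2 3 isT.
have l45 : l5 <= l4 := bound 3 4 isT.
set s := l3 + (l4 + (l5 + (l6 + sumn r))).
set n := (l1 + (l2 + s)).+1.
have [big|small] := leqP (l4 * l4.+1) n.
  exists 3, 1, l4.+1, l4.+2, (n %/ l4.+1); split=> //=; first by lia.
  - by lia.
  - by move=> i i3; rewrite ltnS; apply: (bound 3 i); exact: ltnW.
  have e := divn_eq n l4.+1; have rl := ltn_pmod n (ltn0Sn l4).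
  by split=> //; [nia | apply/andP; split; nia].
have short i : 1 < i -> nth 0 [:: l1, l2, l3, l4, l5, l6 & r] i <= l3 by exact: (bound 2 i).
have [Q1|Q2] := ltnP (l2.+1 %/ s) 2.
  have : l2.+1 < 2 * s by move: Q1; rewrite ltn_divLR //; lia.
  move=> Ds.
  exists 1, 1, l2.+1, (l2 + s), (n %/ l2.+1); split=> //=; first by lia.
  - by rewrite mul1n.
  - by move=> i /short; lia.
  (* At least two parts, each with slack [s - 1], absorb a remainder of at most [l2 <= 2 s - 2]. *)
  have e := divn_eq n l2.+1; have rl := ltn_pmod n (ltn0Sn l2).
  have m2 : 2 <= n %/ l2.+1 by rewrite leq_divRL //; lia.
  by split=> //; [lia | apply/andP; split; nia].
set Q := l2.+1 %/ s in Q2.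
have ls : 2 * l4.+1 <= s by rewrite /s; lia.
have l3s : l3 < s by rewrite /s; lia.
have [Da bs sA m0 mn] := wide_spider_parameters l12 ls small Q2.
exists 1, Q, (l2 %/ Q).+1, ((l2 + s) %/ Q), (n %/ (l2 %/ Q).+1); split=> //=.
by move=> i /short il3; apply: leq_ltn_trans il3 (leq_trans l3s sA).
Qed.

Theorem theorem3p10 (lam : seq nat) :
  sorted geq lam -> all (fun k => 0 < k) lam -> 6 <= size lam ->
  (exists mu : seq nat,
     int_partition #|spider_vertex lam| mu /\
     ~ (exists P : {set {set spider_vertex lam}},
          connected_partition (@spider_adj lam) P /\ has_type P mu))
  /\ ~ e_positive (@spider_adj lam).
Proof.
move=> ss pos sz.
have [j [Q [a [b [m [jl Da bs short [a0 m0 mn]]]]]]] := spider_parameters ss pos sz.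
have [mu [Pmu Smu]] := balanced_parts m0 a0 mn; rewrite -card_spider in Pmu.
have noP (P : {set {set spider_vertex lam}}) :
    connected_partition (@spider_adj lam) P -> ~ (forall B, B \in P -> a <= #|B| <= b).
  exact: spider_no_partition jl Da bs short.
split.
  exists mu; split=> // -[P [cP tP]]; apply: (noP P cP) => B BP.
  by apply: (allP Smu); rewrite -(perm_mem tP) map_f ?mem_enum.
move=> epos.
have [P [cP SP]] := e_positive_connected_partition (@spider_depth_parent lam)
  (@spider_adj_parent lam) (S := fun k => a <= k <= b) epos Pmu Smu.
exact: (noP P cP SP).
Qed.
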